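(* Let $d\geq 2$ be an integer and let $d'$ be the smallest even integer greater than $d$. Let $f:\mathbb{R}^n\to\mathbb{R}$ be $d$ times continuously differentiable and strongly convex, i.e. there exists a constant $\mu>0$ such that $\nabla^2 f(x)\succeq\mu I$ for all $x\in\mathbb{R}^n$. Let $g_1,\dots,g_m:\mathbb{R}^n\to\mathbb{R}$ be SOS-convex polynomials such that the feasible set $C:=\{x\in\mathbb{R}^n: g_i(x)\leq 0,\ i=1,\dots,m\}$ has nonempty interior. Then, for every $x\in\mathbb{R}^n$: (i) the problem of minimizing $t$ over all $t\in\mathbb{R}$ such that $t\geq 0$ and the polynomial $y\mapsto T_{x,d}(y)+t\|y-x\|^{d'}$ is SOS-convex is feasible; (ii) the problem of minimizing $\psi_{x,d}(y)$ over $y\in C$ has a unique optimal solution.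
   Context: $\|\cdot\|$ denotes the Euclidean norm on $\mathbb{R}^n$. A polynomial is a sum of squares (SOS) if it is a finite sum of squares of real polynomials. A polynomial $p:\mathbb{R}^n\to\mathbb{R}$ is SOS-convex if the polynomial $(x,y)\mapsto\langle\nabla^2p(x)y,y\rangle$ on $\mathbb{R}^n\times\mathbb{R}^n$ is SOS. $T_{x,d}(y):=\sum_{k=0}^{d}\frac{1}{k!}\nabla^kf(x)[y-x,\dots,y-x]$ is the $d$th-order Taylor expansion of $f$ at $x$, where $\nabla^k f(x)$ is the symmetric tensor of $k$th-order partial derivatives, applied to $k$ copies of $y-x$. $t(x):=\min\{t\in\mathbb{R}: t\geq 0,\ y\mapsto T_{x,d}(y)+t\|y-x\|^{d'}\text{ is SOS-convex}\}$, and $\psi_{x,d}(y):=T_{x,d}(y)+t(x)\|y-x\|^{d'}$. *)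

(* Defs.v *)
From HB Require Import structures.
From mathcomp Require Import all_boot all_order all_algebra.
From mathcomp Require mpoly.
From mathcomp Require Import all_classical all_reals all_analysis.

Set Implicit Arguments.
Unset Strict Implicit.
Unset Printing Implicit Defensive.

Import Order.TTheory GRing.Theory Num.Theory.
Import numFieldNormedType.Exports.
(* The notations of mpoly clash with those of mathcomp-analysis. *)
Import -(notations) mpoly.

Local Open Scope classical_set_scope.
Local Open Scope ring_scope.

Section Euclidean.
Context {R : realType} {n : nat}.
Implicit Types u v : 'rV[R]_n.

Definition dotv u v : R := \sum_(i < n) u 0 i * v 0 i.

(* The library norm on ['rV[R]_n] is the sup norm; it induces the same topology
   as this one. *)
Definition enorm v : R := Num.sqrt (dotv v v).

(* [loewner_le A B] is A <= B in the Loewner order. *)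
Definition loewner_le (A B : 'M[R]_n) : Prop :=
  forall v, 0 <= dotv (v *m (B - A)) v.

End Euclidean.

Section Derivatives.
Context {R : realType} {n : nat}.
Implicit Types (f : 'rV[R]_n -> R) (x y v : 'rV[R]_n).

Definition evec (i : 'I_n) : 'rV[R]_n := delta_mx 0 i.

(* [partials s f] for s = [:: i_1; ...; i_k] is d_(i_1) (... (d_(i_k) f)). *)
Definition partials (s : seq 'I_n) f : 'rV[R]_n -> R :=
  foldr (fun i g => 'D_(evec i) g) f s.

(* All iterated partial derivatives of order at most d exist everywhere and are
   continuous. The existence clause is needed because ['D_v] is total. *)
Definition continuously_differentiable (d : nat) f : Prop :=
  forall s : seq 'I_n, (size s <= d)%N ->
    continuous (partials s f) /\
    ((size s < d)%N -> forall i x, derivable (partials s f) x (evec i)).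

Definition hessian f x : 'M[R]_n := \matrix_(i, j) partials [:: i; j] f x.

Definition strongly_convex f : Prop :=
  exists2 mu : R, 0 < mu & forall x, loewner_le mu%:M (hessian f x).

(* The symmetric tensor of k-th order partial derivatives of f at x, applied to
   k copies of v. *)
Definition tensor_pow (k : nat) f x v : R :=
  \sum_(s : k.-tuple 'I_n) partials s f x * \prod_(i <- s) v 0 i.

Definition taylor (d : nat) f x y : R :=
  \sum_(k < d.+1) (k`!%:R)^-1 * tensor_pow k f x (y - x).

End Derivatives.

Section SOSConvexity.
Context {R : realType}.

Definition sos (n : nat) (p : mpoly n R) : Prop :=
  exists s : seq (mpoly n R), p = \sum_(q <- s) q ^+ 2.

Definition peval (n : nat) (p : mpoly n R) (y : 'rV[R]_n) : R :=
  meval (fun i => y 0 i) p.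

Definition pvar (n : nat) (i : 'I_n) : mpoly n R :=
  mpolyX R (mnm1 i).

(* The polynomial (x, y) |-> <hess p(x) y, y>, with x given by the first n
   variables and y by the last n. *)
Definition hessian_form (n : nat) (p : mpoly n R) : mpoly (n + n) R :=
  \sum_(i < n) \sum_(j < n)
    comp_mpoly [tuple pvar (lshift n k) | k < n]
      (mderiv i (mderiv j p)) *
    pvar (rshift n i) * pvar (rshift n j).

(* R is infinite, so the polynomial representing a function is unique. *)
Definition sos_convex (n : nat) (p : 'rV[R]_n -> R) : Prop :=
  exists2 P : mpoly n R, p =1 peval P & sos (hessian_form P).

End SOSConvexity.

Section Subproblem.
Context {R : realType} {n : nat}.
Variables (d d' : nat) (f : 'rV[R]_n -> R) (x : 'rV[R]_n).

Definition regularized_taylor (t : R) (y : 'rV[R]_n) : R :=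
  taylor d f x y + t * enorm (y - x) ^+ d'.

Definition feasible_weights : set R :=
  [set t | 0 <= t /\ sos_convex (regularized_taylor t)].

Definition minima (A : set R) : set R := A `&` lbound A.

(* The least element of [feasible_weights]; the value is meaningful only when
   that set has one. *)
Definition tmin : R := xget 0 (minima feasible_weights).

Definition psi : 'rV[R]_n -> R := regularized_taylor tmin.

End Subproblem.

Definition optimal_solution {T : Type} {R : realType} (h : T -> R) (C : set T) (y : T) :
  Prop := C y /\ forall z, C z -> h y <= h z.

Definition smallest_even_gt (d d' : nat) : Prop :=
  [/\ ~~ odd d', (d < d')%N & forall e, ~~ odd e -> (d < e)%N -> (d' <= e)%N].

(* Main.v *)
Require Import Defs.
From mathcomp Require Import all_boot all_order all_algebra.
From mathcomp Require mpoly polyorder polyrcf.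
From mathcomp Require Import all_classical all_reals all_analysis.
From mathcomp Require Import ring lra.
Import Order.TTheory GRing.Theory Num.Theory.
Import numFieldNormedType.Exports.
Import -(notations) mpoly.

(* At y = x the Hessian of y |-> T(y) + t |y - x|^d' is that of f, hence at
   least mu I.  In the variables u = y - x and v, the remaining terms of the
   Hessian form of T are multiples of u^a v_i v_j with 1 <= |a| <= d' - 3; they
   are absorbed, in the sense of sums of squares, by mu |v|^2 + t |u|^(d'-2) |v|^2
   for large t, and the Hessian form of |u|^d' minus 2 |u|^(d'-2) |v|^2 is itself
   a sum of squares.  This gives feasibility.  The least weight exists since the
   cone of sums of squares of bounded degree is closed: a bounded number of
   squares suffices, and the coefficients of the squares are bounded in terms of
   those of their sum.

   On every line the polynomial psi is convex, and on a line through x it is a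
   convex polynomial with positive second derivative at x, so it tends to
   infinity.  By compactness of the sphere its sublevel sets are bounded, and a
   minimizer over the closed set C exists.  If psi had two minimizers, it would be
   constant on the line through them, and then by convexity and continuity
   bounded above on the parallel line through x, a contradiction. *)

Set Implicit Arguments.
Unset Strict Implicit.
Unset Printing Implicit Defensive.

Local Open Scope classical_set_scope.
Local Open Scope ring_scope.

(** * Sums of squares and quadratic forms *)

Section SumsOfSquares.
Context {R : realType} {n : nat}.
Implicit Types (p q : mpoly n R) (c : R).

Lemma sos0 : sos (0 : mpoly n R).
Proof. by exists [::]; rewrite big_nil. Qed.

Lemma sos_sqr p : sos (p ^+ 2).
Proof. by exists [:: p]; rewrite big_seq1. Qed.

Lemma sosD p q : sos p -> sos q -> sos (p + q).
Proof. by move=> [s ->] [t ->]; exists (s ++ t); rewrite big_cat. Qed.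

Lemma sosM p q : sos p -> sos q -> sos (p * q).
Proof.
move=> [s ->] [t ->]; exists [seq a * b | a <- s, b <- t].
rewrite big_allpairs_dep mulr_suml; apply: eq_bigr => a _.
by rewrite mulr_sumr; apply: eq_bigr => b _; rewrite exprMn.
Qed.

Lemma sosZ c p : 0 <= c -> sos p -> sos (c *: p).
Proof.
move=> c0 [s ->]; exists [seq Num.sqrt c *: a | a <- s].
rewrite big_map scaler_sumr; apply: eq_bigr => a _.
by rewrite exprZn sqr_sqrtr.
Qed.

Lemma sos_sum (I : Type) (r : seq I) (P : pred I) (F : I -> mpoly n R) :
  (forall i, P i -> sos (F i)) -> sos (\sum_(i <- r | P i) F i).
Proof. by move=> F_sos; elim/big_rec: _ => [|i q Pi]; [exact: sos0|exact/sosD/F_sos]. Qed.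

Lemma sosX p k : sos p -> sos (p ^+ k).
Proof.
move=> p_sos; elim: k => [|k IH]; last by rewrite exprS; exact: sosM.
by rewrite expr0 -[1](expr1n _ 2); exact: sos_sqr.
Qed.

(** Multiplication of inequalities for the order [sos (q - p)], by inserting the mixed product
    [p * s]. *)
Lemma sosB_mul p q r s : sos p -> sos s ->
  sos (q - p) -> sos (s - r) -> sos (q * s - p * r).
Proof.
move=> p0 s0 pq rs; have -> : q * s - p * r = (q - p) * s + p * (s - r) by ring.
by apply: sosD; apply: sosM.
Qed.

End SumsOfSquares.


(** Over an arbitrary commutative algebra, so that one matrix can be tested for positivity on reals
    and then evaluated on polynomials. *)
Definition quad_form {R : realType} (S : comAlgType R) n (B : 'I_n -> 'I_n -> R)
  (z : 'I_n -> S) : S := \sum_i \sum_j B i j *: (z i * z j).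

(* At a zero pivot [B 0 0] the junk value [0^-1 = 0] makes the identity true
   as long as the rest of the pivot row vanishes as well. *)
Lemma quad_form_schur {R : realType} (S : comAlgType R) n (B : 'I_n.+1 -> 'I_n.+1 -> R)
    (z : 'I_n.+1 -> S) : (forall i j, B i j = B j i) ->
    (forall j, B 0 0 * (B 0 j / B 0 0) = B 0 j) ->
  quad_form B z = B 0 0 *: (z 0 + \sum_(j < n) (B 0 (lift 0 j) / B 0 0) *: z (lift 0 j)) ^+ 2
    + quad_form (fun i j => B (lift 0 i) (lift 0 j)
                            - B 0 (lift 0 i) * B 0 (lift 0 j) / B 0 0) (fun i => z (lift 0 i)).
Proof.
move=> symB pivot; set w := \sum_(j < n) _.
have Bw : B 0 0 *: w = \sum_(j < n) B 0 (lift 0 j) *: z (lift 0 j).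
  by rewrite scaler_sumr; apply: eq_bigr => j _; rewrite scalerA pivot.
have Bww : B 0 0 *: w ^+ 2 = \sum_i \sum_j
    (B 0 (lift 0 i) * B 0 (lift 0 j) / B 0 0) *: (z (lift 0 i) * z (lift 0 j)).
  rewrite expr2 scalerAl Bw mulr_suml; apply: eq_bigr => i _.
  rewrite mulr_sumr; apply: eq_bigr => j _.
  by rewrite -scalerAl -scalerAr scalerA mulrA.
rewrite sqrrD !scalerDr Bww (scalerAr _ (z 0) w) Bw /quad_form.
under [X in _ = _ + X]eq_bigr do
  (under eq_bigr do rewrite scalerBl; rewrite sumrB).
rewrite sumrB addrACA subrr addr0 big_ord_recl.
rewrite big_ord_recl; under [X in _ + X = _]eq_bigr do rewrite big_ord_recl.
rewrite big_split /= -!addrA; congr (_ + _); rewrite !addrA; congr (_ + _).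
rewrite mulr_sumr; congr (_ + _); apply: eq_bigr => i _; first by rewrite scalerAr.
by rewrite -scalerAr symB [z _ * z ord0]mulrC.
Qed.

(** Cholesky factorization by induction on the size: the Schur identity splits off one square, and
    the Schur complement is again positive semidefinite. Positivity is tested on reals only, while
    the factorization is an identity in [S]. *)
Lemma psd_quad_form {R : realType} (S : comAlgType R) n (B : 'I_n -> 'I_n -> R) :
  (forall i j, B i j = B j i) -> (forall v : 'I_n -> R^o, 0 <= quad_form B v) ->
  exists L : 'M[R]_n, forall z : 'I_n -> S,
    quad_form B z = \sum_i (\sum_j L i j *: z j) ^+ 2.
Proof.
elim: n B => [|n IH] B symB psd.
  by exists 0 => z; rewrite /quad_form !big_ord0.
have ext (s : R) (c : 'I_n -> R) : 0 <= s ^+ 2 * B 0 0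
    + 2 * s * (\sum_i B 0 (lift 0 i) * c i)
    + \sum_i \sum_j B (lift 0 i) (lift 0 j) * (c i * c j).
  pose v i : R^o := if unlift 0 i is Some l then c l else s.
  have v0 : v 0 = s by rewrite /v unlift_none.
  have vl i : v (lift 0 i) = c i by rewrite /v liftK.
  have := psd v; congr (_ <= _); clearbody v; rewrite /quad_form.
  rewrite big_ord_recl; under [X in _ + X = _]eq_bigr do rewrite big_ord_recl.
  rewrite big_ord_recl big_split /= addrA; congr (_ + _).
    rewrite v0 -addrA; congr (_ + _); first by rewrite /GRing.scale/= -expr2 mulrC.
    rewrite mulrDl mulrDl mul1r mulr_sumr; congr (_ + _); apply: eq_bigr => i _.
      by rewrite /GRing.scale/= vl; ring.
    by rewrite /GRing.scale/= vl symB; ring.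
  by apply: eq_bigr => i _; apply: eq_bigr => j _; rewrite /GRing.scale/= !vl.
have B00 : 0 <= B 0 0.
  have := ext 1 (fun=> 0); rewrite expr1n mul1r big1 => [|i _]; last by rewrite mulr0.
  by rewrite mulr0 addr0 big1 ?addr0// => i _; rewrite big1// => j _; rewrite !mulr0.
have pivot j : B 0 0 * (B 0 j / B 0 0) = B 0 j.
  have [B0|/eqP B0] := eqVneq (B 0 0) 0; last by field; apply/eqP.
  rewrite B0 mul0r; case: (unliftP 0 j) => [{}j ->|->//]; apply/esym/eqP.
  have delta (c : 'I_n -> R) : \sum_i c i * (i == j)%:R = c j.
    rewrite (bigD1 j)//= eqxx mulr1 big1 ?addr0// => l /negbTE ->.
    by rewrite mulr0.
  (* At a zero pivot the form at (s, e_j) is affine in s, so its slope must vanish. The value of s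
     tested below would make it equal to -1. *)
  have diag s : 0 <= 2 * s * B 0 (lift 0 j) + B (lift 0 j) (lift 0 j).
    have := ext s (fun i => (i == j)%:R); rewrite B0 mulr0 add0r delta.
    under eq_bigr do (under eq_bigr do rewrite mulrA; rewrite delta).
    by rewrite delta.
  move: diag; set b := B 0 _; set c := B _ _ => diag; apply: contraT => b0.
  have := diag (- (c + 1) / (2 * b)).
  have -> : 2 * (- (c + 1) / (2 * b)) * b + c = -1 by field.
  by lra.
have [i j|v|L schurE] := IH (fun i j => B (lift 0 i) (lift 0 j)
                                 - B 0 (lift 0 i) * B 0 (lift 0 j) / B 0 0).
- by rewrite symB [B 0 _ * _]mulrC.
(* The first coordinate is chosen to annihilate the square, so the form at [v'] is the Schur
   complement at [v]. *)
- pose v' i : R^o := if unlift 0 i is Some j then v j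
    else - \sum_(j < n) (B 0 (lift 0 j) / B 0 0) *: v j.
  have v'l i : v' (lift 0 i) = v i by rewrite /v' liftK.
  have v'0 : v' 0 + \sum_(j < n) (B 0 (lift 0 j) / B 0 0) *: v' (lift 0 j) = 0.
    have -> : v' 0 = - \sum_(j < n) (B 0 (lift 0 j) / B 0 0) *: v j by rewrite /v' unlift_none.
    by under [X in _ + X]eq_bigr do rewrite v'l; rewrite addNr.
  have := psd v'; rewrite quad_form_schur// v'0 expr0n scaler0 add0r; congr (_ <= _).
  by apply: eq_bigr => i _; apply: eq_bigr => j _; rewrite !v'l.
pose r := Num.sqrt (B 0 0).
pose L' i j := match unlift 0 i, unlift 0 j with
  | None, None => r
  | None, Some j => r * (B 0 (lift 0 j) / B 0 0)
  | Some i, None => 0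
  | Some i, Some j => L i j end.
exists (\matrix_(i, j) L' i j) => z; rewrite quad_form_schur// schurE big_ord_recl.
congr (_ + _).
  rewrite big_ord_recl mxE /L' !unlift_none.
  under [in RHS]eq_bigr do rewrite mxE unlift_none liftK -scalerA.
  by rewrite -scaler_sumr -scalerDr exprZn sqr_sqrtr.
apply: eq_bigr => i _; congr (_ ^+ 2); rewrite big_ord_recl mxE /L' liftK unlift_none.
by rewrite scale0r add0r; apply: eq_bigr => j _; rewrite mxE !liftK.
Qed.

Lemma sos_quad_form {R : realType} k n (B : 'I_n -> 'I_n -> R) (z : 'I_n -> mpoly k R) :
  (forall i j, B i j = B j i) -> (forall v : 'I_n -> R^o, 0 <= quad_form B v) ->
  sos (quad_form B z).
Proof.
move=> symB psdB; have [L ->] := psd_quad_form (mpoly k R) symB psdB.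
by apply: sos_sum => i _; exact: sos_sqr.
Qed.

(** * The Hessian form *)

Section HessianForm.
Context {R : realType} {n : nat}.
Implicit Types (p q : mpoly n R) (c : R).

(* [lift_left], [grad_form] and [hessian_form] are the orders 0, 1 and 2 of the
   expansion of [p (x + y)] in powers of [y], up to the factor [1 / k!]. *)
Definition lift_left p : mpoly (n + n) R :=
  comp_mpoly [tuple pvar (lshift n k) | k < n] p.

Definition grad_form p : mpoly (n + n) R :=
  \sum_(i < n) lift_left (mderiv i p) * pvar (rshift n i).

Lemma lift_leftD : {morph lift_left : p q / p + q}.
Proof. exact: comp_mpolyD. Qed.

Lemma lift_leftM : {morph lift_left : p q / p * q}.
Proof. by move=> p q; rewrite /lift_left rmorphM. Qed.

Lemma lift_left1 : lift_left 1 = 1.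
Proof. exact: comp_mpoly1. Qed.

Lemma lift_left0 : lift_left 0 = 0.
Proof. exact: comp_mpoly0. Qed.

Lemma lift_leftX p k : lift_left (p ^+ k) = lift_left p ^+ k.
Proof.
by elim: k => [|k IH]; rewrite ?lift_left1// !exprS lift_leftM IH.
Qed.

Lemma grad_formM p q :
  grad_form (p * q) = grad_form p * lift_left q + lift_left p * grad_form q.
Proof.
rewrite /grad_form mulr_suml mulr_sumr -big_split/=; apply: eq_bigr => i _.
by rewrite mderivM lift_leftD !lift_leftM; ring.
Qed.

Lemma hessian_formE p : hessian_form p =
  \sum_(i < n) grad_form (mderiv i p) * pvar (rshift n i).
Proof.
rewrite /hessian_form; apply: eq_bigr => i _; rewrite mulr_suml.
by apply: eq_bigr => j _; rewrite mderiv_comm -!mulrA [pvar _ * pvar _]mulrC.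
Qed.

Lemma grad_formD : {morph grad_form : p q / p + q}.
Proof.
move=> p q; rewrite -big_split; apply: eq_bigr => i _.
by rewrite mderivD lift_leftD mulrDl.
Qed.

Lemma hessian_formM p q : hessian_form (p * q) =
  hessian_form p * lift_left q + 2%:R * (grad_form p * grad_form q)
    + lift_left p * hessian_form q.
Proof.
have -> : 2%:R * (grad_form p * grad_form q) =
    \sum_i lift_left (mderiv i p) * pvar (rshift n i) * grad_form q +
    \sum_i grad_form p * (lift_left (mderiv i q) * pvar (rshift n i)).
  by rewrite -mulr_suml -mulr_sumr mulr_natl mulr2n.
rewrite !hessian_formE mulr_suml mulr_sumr.
under eq_bigr do rewrite mderivM grad_formD !grad_formM.
by rewrite -!big_split; apply: eq_bigr => i _ /=; ring.
Qed.

Lemma hessian_formD : {morph @hessian_form R n : p q / p + q}.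
Proof.
move=> p q; rewrite !hessian_formE -big_split; apply: eq_bigr => i _.
by rewrite mderivD grad_formD mulrDl.
Qed.

Lemma hessian_form0 : hessian_form 0 = 0 :> mpoly (n + n) R.
Proof. by apply/(@addrI _ (hessian_form 0)); rewrite -hessian_formD !addr0. Qed.

Lemma hessian_formZ c p : hessian_form (c *: p) = c *: hessian_form p.
Proof.
rewrite /hessian_form scaler_sumr; apply: eq_bigr => i _.
rewrite scaler_sumr; apply: eq_bigr => j _.
by rewrite !mderivZ comp_mpolyZ -!scalerAl.
Qed.

Lemma hessian_form_sum (I : Type) (r : seq I) (F : I -> mpoly n R) :
  hessian_form (\sum_(i <- r) F i) = \sum_(i <- r) hessian_form (F i).
Proof. exact: (big_morph _ hessian_formD hessian_form0). Qed.

Lemma grad_form1 : grad_form 1 = 0.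
Proof. by rewrite /grad_form big1// => i _; rewrite mderivC lift_left0 mul0r. Qed.

Lemma hessian_form1 : hessian_form 1 = 0 :> mpoly (n + n) R.
Proof.
rewrite hessian_formE big1// => i _.
by rewrite mderivC /grad_form big1 ?mul0r// => j _; rewrite mderiv0 lift_left0 mul0r.
Qed.

Lemma mderiv_varB i j c : mderiv j (pvar i - mpolyC n c) = mpolyC n (i == j)%:R.
Proof.
rewrite mderivB mderivC subr0 mderivX mnm1E -mul_mpolyC.
case: eqP => [->|_]; last by rewrite mpolyC0 mul0r.
rewrite (_ : mnm_sub _ _ = mnm0) ?mpolyX0 ?mulr1//.
by apply/mnmP => k; rewrite mnmBE subnn mnm0E.
Qed.

Lemma grad_form_varB i c : grad_form (pvar i - mpolyC n c) = pvar (rshift n i).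
Proof.
rewrite /grad_form (bigD1 i)//= big1 => [|j /negbTE ji].
  by rewrite addr0 mderiv_varB eqxx lift_left1 mul1r.
by rewrite mderiv_varB eq_sym ji mpolyC0 lift_left0 mul0r.
Qed.

Lemma hessian_form_varB i c : hessian_form (pvar i - mpolyC n c) = 0.
Proof.
rewrite hessian_formE big1// => j _; rewrite mderiv_varB.
rewrite /grad_form big1 ?mul0r// => k _.
by rewrite mderivC lift_left0 mul0r.
Qed.

End HessianForm.

(** * Absorbing lower-order terms *)

Section PowerBounds.
Context {R : realType} {n : nat}.
Variable s : mpoly n R.
Hypothesis s_sos : sos s.

Lemma sos_young (p q : mpoly n R) (c d : R) : 0 < d ->
  sos (d *: p ^+ 2 + c *: (p * q) + (c ^+ 2 / (4 * d)) *: q ^+ 2).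
Proof.
move=> d0; have dn0 : d != 0 by rewrite gt_eqF.
pose e := c / (2 * d); have -> : c = 2 * d * e by rewrite /e; field.
have -> : (2 * d * e) ^+ 2 / (4 * d) = d * e ^+ 2 by field.
rewrite (_ : _ + _ + _ = d *: (p + e *: q) ^+ 2); last by rewrite -!mul_mpolyC; ring.
by apply: sosZ; [exact: ltW|exact: sos_sqr].
Qed.

(** Induction on [j]: completing a square bounds (c + 1) s^(j+2) by multiples of s^(j+1) and
    s^(j+3), and the induction hypothesis bounds s^(j+1) by a constant and a multiple of s^(j+2). *)
Lemma sos_power_step j (c e : R) : 0 < e ->
  exists2 t : R, 0 <= t & sos (e *: 1 + t *: s ^+ j.+2 - c *: s ^+ j.+1).
Proof.
elim: j c e => [|j IH] c e e0.
  exists ((- c) ^+ 2 / (4 * e)); first by rewrite divr_ge0 ?sqr_ge0// mulr_ge0// ltW.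
  rewrite (_ : _ - _ = e *: 1 ^+ 2 + (- c) *: (1 * s) + ((- c) ^+ 2 / (4 * e)) *: s ^+ 2).
    exact: sos_young.
  by rewrite -!mul_mpolyC; ring.
have [t1 t1_ge0 IHt] := IH 1 e e0.
(* With d (1 + t1) = 1 the constants add up to [e], and the coefficient d t1 of s^(j+2) from the
   induction hypothesis, together with a slack d, cancels the extra 1 in c + 1. *)
pose d := (1 + t1)^-1; have t11 : 0 < 1 + t1 by rewrite ltr_pwDl.
have d0 : 0 < d by rewrite invr_gt0.
have dt1 : d + d * t1 = 1 by rewrite -[X in X + _]mulr1 -mulrDr mulVf// gt_eqF.
set K := (- (c + 1)) ^+ 2 / (4 * d).
exists K; first by rewrite divr_ge0 ?sqr_ge0// mulr_ge0// ltW.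
rewrite (_ : _ - _ = d *: (e *: 1 + t1 *: s ^+ j.+2 - 1 *: s ^+ j.+1)
   + s ^+ j.+1 * (d *: 1 ^+ 2 + (- (c + 1)) *: (1 * s) + K *: s ^+ 2)
   + (e * (d * t1)) *: 1 + d *: s ^+ j.+2); last first.
  rewrite -!mul_mpolyC !exprS; move: (s ^+ j) K => sj K.
  apply/eqP; rewrite -subr_eq0; apply/eqP.
  transitivity ((1 - (mpolyC n d + mpolyC n d * mpolyC n t1)) * (mpolyC n e + s ^+ 2 * sj)).
    by ring.
  by rewrite -mpolyCM -mpolyCD dt1 mpolyC1 subrr mul0r.
apply: sosD; last by apply: sosZ; [exact: ltW|exact: sosX].
apply: sosD; last first.
  by apply: sosZ; [exact: (mulr_ge0 (ltW e0) (mulr_ge0 (ltW d0) t1_ge0))|exact: (sosX 0 s_sos)].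
apply: sosD; first by apply: sosZ => //; exact: ltW.
by apply: sosM; [exact: sosX|exact: sos_young].
Qed.

(** Iterates the single step from exponent [j] up to [p], spending half of the remaining constant
    each time. *)
Lemma sos_power_le j p (c e : R) : (0 < j <= p)%N -> 0 < e ->
  exists2 t : R, 0 <= t & sos (e *: 1 + t *: s ^+ p - c *: s ^+ j).
Proof.
move=> /andP[j0 /subnK <-]; move: (p - j)%N => k; elim: k j j0 c e => {p} [|k IH] j j0 c e e0.
  exists `|c| => //; rewrite add0n -addrA -scalerBl; apply: sosD.
    by apply: sosZ; [exact: ltW|exact: (sosX 0 s_sos)].
  by apply: sosZ; [rewrite subr_ge0 ler_norm|exact: sosX].
case: j j0 => // j _; have e20 : 0 < e / 2 by rewrite divr_gt0.
have [t1 _ step] := sos_power_step j c e20.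
have [t2 t20 IHt] := IH j.+2 isT t1 _ e20; exists t2 => //.
rewrite addSnnS; move: (sosD step IHt); congr sos.
rewrite [X in _ = X *: 1 + _ - _](splitr e) scalerDl; rewrite -!mul_mpolyC; ring.
Qed.

End PowerBounds.

Section Domination.
Context {R : realType} {N n : nat}.
Variables u v : 'I_n -> mpoly N R.

Let U := \sum_i u i ^+ 2.
Let V := \sum_i v i ^+ 2.

Definition umon (r : seq 'I_n) := \prod_(i <- r) u i.

Let U_sos : sos U. Proof. by apply: sos_sum => i _; exact: sos_sqr. Qed.
Let V_sos : sos V. Proof. by apply: sos_sum => i _; exact: sos_sqr. Qed.

Lemma sos_sum_sqrB (w : 'I_n -> mpoly N R) i : sos (\sum_j w j ^+ 2 - w i ^+ 2).
Proof.
by rewrite (bigD1 i)//= addrAC subrr add0r; apply: sos_sum => j _; exact: sos_sqr.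
Qed.

Lemma umon_sqr_le r : sos (U ^+ size r - umon r ^+ 2).
Proof.
elim: r => [|i r IH]; first by rewrite /umon big_nil expr1n subrr; exact: sos0.
rewrite /umon big_cons exprMn (exprS U); apply: sosB_mul; last exact: IH.
- exact: sos_sqr.
- exact: sosX.
- exact: sos_sum_sqrB.
Qed.

(* All real multiples of [h] are absorbed by [V + U ^+ p * V] with an
   arbitrarily small weight on [V]. *)
Definition dominated p (h : mpoly N R) := forall c e : R, 0 < e ->
  exists2 t : R, 0 <= t & sos (e *: V + t *: (U ^+ p * V) + c *: h).

Lemma dominated0 p : dominated p 0.
Proof.
move=> c e e0; exists 0 => //; rewrite scale0r scaler0 !addr0.
by apply: sosZ => //; exact: ltW.
Qed.

Lemma dominatedD p h1 h2 : dominated p h1 -> dominated p h2 -> dominated p (h1 + h2).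
Proof.
move=> dom1 dom2 c e e0; have e20 : 0 < e / 2 by rewrite divr_gt0.
have [t1 t10 s1] := dom1 c _ e20; have [t2 t20 s2] := dom2 c _ e20.
exists (t1 + t2); first exact: addr_ge0.
move: (sosD s1 s2); congr sos.
by rewrite [X in _ = X *: V + _ + _](splitr e) -!mul_mpolyC; ring.
Qed.

Lemma dominatedZ p a h : dominated p h -> dominated p (a *: h).
Proof.
by move=> dom c e e0; have [t t0 st] := dom (c * a) e e0; exists t; rewrite ?scalerA.
Qed.

Lemma dominated_sum p (I : Type) (r : seq I) (P : pred I) (F : I -> mpoly N R) :
  (forall i, P i -> dominated p (F i)) -> dominated p (\sum_(i <- r | P i) F i).
Proof.
move=> F_dom; elim/big_rec: _ => [|i h Pi]; first exact: dominated0.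
exact/dominatedD/F_dom.
Qed.

(* Split [r] into halves [b] and [g] and apply the inequality of arithmetic and
   geometric means to [(v i * umon b) * (v j * umon g)]. *)
Lemma dominated_umon p i j r : (0 < size r <= p.*2)%N -> dominated p (v i * v j * umon r).
Proof.
move=> /andP[r0 rp] c e e0; have d0 : 0 < e / 2 by rewrite divr_gt0.
set d := e / 2 in d0; pose K := c ^+ 2 / (4 * d).
have K0 : 0 <= K by rewrite divr_ge0 ?sqr_ge0// mulr_ge0// ltW.
pose b := take (size r)./2 r; pose g := drop (size r)./2 r.
have sb : size b = (size r)./2 by rewrite size_takel// leq_half_double -addnn leqW ?leq_addr.
have sg : size g = uphalf (size r) by rewrite size_drop uphalf_half -{1}(odd_double_half (size r)) -addnn addnA addnK.
(* The half [b] is empty when [r] has a single element; then U^0 = 1 is absorbed by the constant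
   alone. *)
have [t1 t10 st1] : exists2 t : R, 0 <= t & sos (d *: 1 + t *: U ^+ p - d *: U ^+ size b).
  have [b0|b0] := posnP (size b).
    by exists 0; rewrite // b0 expr0 scale0r addr0 subrr; exact: sos0.
  by apply: sos_power_le => //; rewrite b0 sb leq_half_double// (leq_trans rp)// leqnSn.
have [t2 t20 st2] : exists2 t : R, 0 <= t & sos (d *: 1 + t *: U ^+ p - K *: U ^+ size g).
  by apply: sos_power_le => //; rewrite sg uphalf_gt0 r0 leq_uphalf_double.
have dom w k (s : seq 'I_n) : w = v k * umon s -> sos (V * U ^+ size s - w ^+ 2).
  move=> ->; rewrite exprMn; apply: sosB_mul; last exact: umon_sqr_le.
  - exact: sos_sqr.
  - exact: sosX.
  - exact: sos_sum_sqrB.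
have rE : umon r = umon b * umon g by rewrite /umon -big_cat cat_take_drop.
exists (t1 + t2); first exact: addr_ge0.
(* Young's inequality leaves d (v_i u^b)^2 and K (v_j u^g)^2. These are at most d V U^|b| and K V
   U^|g|, and the powers of U are bounded by constants and U^p. The two constants d add up to
   [e]. *)
have := sosD (sosD (sosM V_sos st1) (sosM V_sos st2))
  (sosD (sosD (sosZ (ltW d0) (dom _ i b erefl)) (sosZ K0 (dom _ j g erefl)))
        (sos_young (v i * umon b) (v j * umon g) c d0)).
congr sos; rewrite -/K rE [X in _ = X *: V + _ + _](splitr e) -/d -!mul_mpolyC.
move: (U ^+ p) (U ^+ _) (U ^+ _) => Up Ub Ug; ring.
Qed.

End Domination.

(** * The Taylor polynomial *)

(** The factorization asks for a symmetric matrix, and symmetry of the Hessian is not assumed; a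
    quadratic form depends only on the symmetric part. *)
Lemma quad_form_sym_part {R : realType} (S : comAlgType R) n (A : 'M[R]_n) (mu : R)
    (z : 'I_n -> S) :
  quad_form (fun i j => (A i j + A j i) / 2 - mu * (i == j)%:R) z
    = quad_form A z - mu *: \sum_i z i ^+ 2.
Proof.
have -> : quad_form A z = quad_form (fun i j => A i j / 2) z + quad_form (fun i j => A j i / 2) z.
  rewrite {3}/quad_form exchange_big/= -big_split; apply: eq_bigr => i _.
  rewrite -big_split; apply: eq_bigr => j _ /=.
  by rewrite [z j * z i]mulrC -scalerDl -splitr.
rewrite scaler_sumr -big_split -sumrB; apply: eq_bigr => i _ /=.
rewrite -big_split/= [X in _ = _ - X](_ : _ = \sum_j (mu * (i == j)%:R) *: (z i * z j)).
  by rewrite -sumrB; apply: eq_bigr => j _; rewrite scalerBl mulrDl scalerDl.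
rewrite (bigD1 i)//= eqxx mulr1 big1 ?addr0// => j /negbTE.
by rewrite eq_sym => ->; rewrite mulr0 scale0r.
Qed.

Lemma sos_quad_form_loewner {R : realType} k n (A : 'M[R]_n) (mu : R) (z : 'I_n -> mpoly k R) :
  loewner_le mu%:M A -> sos (quad_form A z - mu *: \sum_i z i ^+ 2).
Proof.
move=> muA; rewrite -quad_form_sym_part; apply: sos_quad_form => [i j|v].
  by rewrite [A i j + _]addrC [i == j]eq_sym.
have := muA (\row_i v i); congr (_ <= _); rewrite quad_form_sym_part.
rewrite mulmxBr mul_mx_scalar /dotv /quad_form scaler_sumr.
under eq_bigr do rewrite !mxE mulrBl.
rewrite sumrB; congr (_ - _); last first.
  by apply: eq_bigr => i _; rewrite /GRing.scale/= mulrA.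
under eq_bigr do rewrite mulr_suml.
rewrite exchange_big; apply: eq_bigr => i _; apply: eq_bigr => j _.
by rewrite !mxE /GRing.scale/=; ring.
Qed.

Section TaylorPolynomial.
Context {R : realType} {n : nat}.
Variable x : 'rV[R]_n.

Definition shifted_var i : mpoly n R := pvar i - mpolyC n (x 0 i).

(** Monomials are indexed by sequences, as in [tensor_pow], so that product rules become inductions
    on sequences. *)
Definition shifted_mon (s : seq 'I_n) : mpoly n R := \prod_(i <- s) shifted_var i.

Definition sqdist_poly : mpoly n R := \sum_i shifted_var i ^+ 2.

Definition taylor_poly d (f : 'rV[R]_n -> R) : mpoly n R :=
  \sum_(k < d.+1) (k`!%:R)^-1 *:
    \sum_(s : k.-tuple 'I_n) partials s f x *: shifted_mon s.

Lemma peval_shifted_var i y : peval (shifted_var i) y = (y - x) 0 i.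
Proof. by rewrite /peval mevalB mevalXU mevalC !mxE. Qed.

Lemma peval_taylor_poly d f y : peval (taylor_poly d f) y = taylor d f x y.
Proof.
rewrite /peval rmorph_sum; apply: eq_bigr => k _; rewrite /= mevalZ; congr (_ * _).
rewrite rmorph_sum; apply: eq_bigr => s _; rewrite /= mevalZ; congr (_ * _).
by rewrite rmorph_prod; apply: eq_bigr => i _; exact: peval_shifted_var.
Qed.

Lemma peval_sqdist_poly k y : peval (sqdist_poly ^+ k) y = enorm (y - x) ^+ k.*2.
Proof.
rewrite /peval rmorphXn -mul2n exprM; congr (_ ^+ _).
rewrite sqr_sqrtr; last by apply: sumr_ge0 => i _; rewrite -expr2 sqr_ge0.
rewrite rmorph_sum; apply: eq_bigr => i _.
by rewrite rmorphXn /= -[meval _ _]/(peval _ _) peval_shifted_var expr2.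
Qed.

Let u i : mpoly (n + n) R := lift_left (shifted_var i).
Let v i : mpoly (n + n) R := pvar (rshift n i).
Let U := \sum_i u i ^+ 2.
Let V := \sum_i v i ^+ 2.

Lemma lift_left_shifted_mon s : lift_left (shifted_mon s) = umon u s.
Proof.
elim: s => [|i s IH]; rewrite /shifted_mon /umon ?big_nil ?big_cons ?lift_left1//.
by rewrite lift_leftM -/(shifted_mon s) IH.
Qed.

Lemma hessian_form_shifted_mon i s : hessian_form (shifted_mon (i :: s)) =
  2%:R * (v i * grad_form (shifted_mon s)) + u i * hessian_form (shifted_mon s).
Proof.
by rewrite /shifted_mon big_cons hessian_formM hessian_form_varB grad_form_varB mul0r add0r.
Qed.

Lemma grad_form_shifted_mon i s : grad_form (shifted_mon (i :: s)) =
  v i * umon u s + u i * grad_form (shifted_mon s).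
Proof.
rewrite {1}/shifted_mon big_cons grad_formM grad_form_varB -/(shifted_mon s).
by rewrite lift_left_shifted_mon.
Qed.

(** By the product rule this is a sum of terms v_i v_j times a monomial in u of degree size r + size
    s - 1, which lies between 1 and 2p. The prefix [r] collects the factors already passed in the
    induction on [s]. *)
Lemma dominated_grad_form p i r s : (1 < size r + size s <= p.*2.+1)%N ->
  dominated u v p (v i * umon u r * grad_form (shifted_mon s)).
Proof.
elim: s r => [|j s IH] r rs.
  by rewrite /shifted_mon big_nil grad_form1 mulr0; exact: dominated0.
rewrite grad_form_shifted_mon mulrDr; apply: dominatedD.
  rewrite (_ : _ * _ = v i * v j * umon u (r ++ s)).
    by apply: dominated_umon; move: rs; rewrite size_cat /= addnS.
  by rewrite /umon big_cat /=; ring.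
rewrite (_ : _ * _ = v i * umon u (j :: r) * grad_form (shifted_mon s)).
  by apply: IH; move: rs; rewrite /= addnS.
by rewrite /umon big_cons; ring.
Qed.

Lemma dominated_hessian_form p r s : (2 < size r + size s <= p.*2.+2)%N ->
  dominated u v p (umon u r * hessian_form (shifted_mon s)).
Proof.
elim: s r => [|j s IH] r rs.
  by rewrite /shifted_mon big_nil hessian_form1 mulr0; exact: dominated0.
rewrite hessian_form_shifted_mon mulrDr; apply: dominatedD.
  rewrite (_ : _ * _ = 2 *: (v j * umon u r * grad_form (shifted_mon s))).
    by apply/dominatedZ/dominated_grad_form; move: rs; rewrite /= addnS.
  by rewrite -mul_mpolyC; ring.
rewrite (_ : _ * _ = umon u (j :: r) * hessian_form (shifted_mon s)).
  by apply: IH; move: rs; rewrite /= addnS.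
by rewrite /umon big_cons; ring.
Qed.

Lemma hessian_form_taylor_poly2 f :
  \sum_(s : 2.-tuple 'I_n) partials s f x *: hessian_form (shifted_mon s)
    = 2 *: quad_form (hessian f x) v.
Proof.
rewrite /quad_form pair_big/= (reindex (fun ij : 'I_n * 'I_n => [tuple ij.1; ij.2])).
  rewrite scaler_sumr; apply: eq_bigr => -[i j] _ /=.
  rewrite !hessian_form_shifted_mon grad_form_shifted_mon /shifted_mon /umon !big_nil.
  rewrite grad_form1 hessian_form1 !(mulr0, addr0, mulr1) /hessian mxE.
  by rewrite mulr_natl -scaler_nat !scalerA mulrC; congr (_ *: _).
exists (fun s : 2.-tuple 'I_n => (thead s, thead (behead_tuple s))) => [[i j] _|s _].
  by congr pair.
by case/tupleP: s => i s; case/tupleP: s => j s; apply: val_inj; rewrite /= (tuple0 s).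
Qed.

Lemma hessian_form_sqdist : hessian_form sqdist_poly = 2 *: V.
Proof.
rewrite hessian_form_sum scaler_sumr; apply: eq_bigr => i _.
rewrite expr2 hessian_formM hessian_form_varB grad_form_varB mul0r mulr0 add0r addr0.
by rewrite -mul_mpolyC -/(v i); ring.
Qed.

Lemma lift_left_sqdist : lift_left sqdist_poly = U.
Proof.
rewrite /sqdist_poly (big_morph _ lift_leftD lift_left0); apply: eq_bigr => i _.
by rewrite expr2 lift_leftM.
Qed.

(** Degrees 0 and 1 have zero Hessian form. In degree 2 it contains no factor u, so it cannot in
    general be absorbed with an arbitrarily small weight on V; those terms are kept aside as the
    Hessian of f at x. *)
Lemma dominated_hessian_form_mon p s : size s != 2 -> (size s <= p.*2.+2)%N ->
  dominated u v p (hessian_form (shifted_mon s)).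
Proof.
case: s => [|i [|j [//|k s]]] _ sp.
- by rewrite /shifted_mon big_nil hessian_form1; exact: dominated0.
- rewrite hessian_form_shifted_mon /shifted_mon big_nil hessian_form1 grad_form1.
  by rewrite !mulr0 addr0; exact: dominated0.
- have := @dominated_hessian_form p [::] [:: i, j, k & s].
  by rewrite {1}/umon big_nil mul1r; exact.
Qed.

Lemma dominated_hessian_form_taylor d p f : (2 <= d <= p.*2.+2)%N ->
  exists2 h, hessian_form (taylor_poly d f) = quad_form (hessian f x) v + h
    & dominated u v p h.
Proof.
move=> /andP[d2 dp]; have d2' : (2 < d.+1)%N by [].
exists (\sum_(k < d.+1 | k != Ordinal d2') (k`!%:R)^-1 *:
  \sum_(s : k.-tuple 'I_n) partials s f x *: hessian_form (shifted_mon s)).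
  rewrite hessian_form_sum; under eq_bigr do rewrite hessian_formZ hessian_form_sum.
  under eq_bigr do under eq_bigr do rewrite hessian_formZ.
  rewrite (bigD1 (Ordinal d2'))//=; congr (_ + _).
  by rewrite hessian_form_taylor_poly2 scalerA mulVf ?scale1r// pnatr_eq0.
apply: dominated_sum => k k2; apply/dominatedZ/dominated_sum => s _; apply: dominatedZ.
apply: dominated_hessian_form_mon; first by rewrite size_tuple.
by rewrite size_tuple (leq_trans _ dp)// -ltnS.
Qed.

End TaylorPolynomial.

Lemma grad_form_exp {R : realType} n (q : mpoly n R) k :
  grad_form (q ^+ k.+1) = k.+1%:R * (lift_left q ^+ k * grad_form q).
Proof.
elim: k => [|k IH]; first by rewrite expr1 !mul1r.
rewrite exprS grad_formM IH lift_leftX.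
by rewrite -[k.+2]addn1 natrD exprS; ring.
Qed.

(** The product rule for q * q^k yields the Hessian form of q times q^k, a nonnegative multiple of
    q^(k-1) times the squared gradient form, and q times the Hessian form of q^k. The last two are
    sums of squares. *)
Lemma sos_hessian_form_exp {R : realType} n (q : mpoly n R) k :
  sos (lift_left q) -> sos (hessian_form q) ->
  sos (hessian_form (q ^+ k.+1) - hessian_form q * lift_left q ^+ k).
Proof.
move=> q_sos Hq_sos; elim: k => [|k IH].
  by rewrite expr1 mulr1 subrr; exact: sos0.
have Hk_sos : sos (hessian_form (q ^+ k.+1)).
  by have := sosD IH (sosM Hq_sos (sosX k q_sos)); rewrite subrK.
rewrite exprS hessian_formM lift_leftX grad_form_exp addrAC [_ + 2%:R * _]addrC addrK.
apply: sosD; last exact: sosM.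
rewrite (_ : _ * _ = (2 * k.+1%:R : R) *: (lift_left q ^+ k * grad_form q ^+ 2)).
  by apply: sosZ; [rewrite mulr_ge0|apply: sosM; [exact: sosX|exact: sos_sqr]].
by rewrite -mul_mpolyC mpolyCM !mpolyC_nat; ring.
Qed.

Lemma sos_hessian_form_sqdistB {R : realType} n (x : 'rV[R]_n) k :
  sos (hessian_form (sqdist_poly x ^+ k.+1) - 2 *: (\sum_i pvar (rshift n i) ^+ 2)
         * (\sum_i lift_left (shifted_var x i) ^+ 2) ^+ k).
Proof.
rewrite -(hessian_form_sqdist x) -(lift_left_sqdist x); apply: sos_hessian_form_exp.
  by rewrite lift_left_sqdist; apply: sos_sum => i _; exact: sos_sqr.
by rewrite hessian_form_sqdist; apply/sosZ/sos_sum => // i _; exact: sos_sqr.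
Qed.

Lemma sos_hessian_form_sqdist {R : realType} n (x : 'rV[R]_n) k :
  sos (hessian_form (sqdist_poly x ^+ k.+1)).
Proof.
rewrite -[hessian_form _](subrK (2 *: (\sum_i pvar (rshift n i) ^+ 2)
         * (\sum_i lift_left (shifted_var x i) ^+ 2) ^+ k)).
apply: sosD; first exact: sos_hessian_form_sqdistB.
by apply: sosM; [apply: sosZ => //|apply: sosX]; apply: sos_sum => i _; exact: sos_sqr.
Qed.

Lemma sos_hessian_form_regularized {R : realType} n (f : 'rV[R]_n -> R) x d p mu :
  (2 <= d <= p.*2.+2)%N -> 0 < mu -> loewner_le mu%:M (hessian f x) ->
  exists2 t, 0 <= t &
    sos (hessian_form (taylor_poly x d f + t *: sqdist_poly x ^+ p.+1)).
Proof.
move=> dp mu0 muA; have [h Hh dom_h] := dominated_hessian_form_taylor x f dp.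
have [t t0] := dom_h 1 mu mu0; pose v (i : 'I_n) : mpoly (n + n) R := pvar (rshift n i); rewrite -/v => st.
(* The Hessian form of the regularizer exceeds 2 U^p V, so half of the weight [t] on U^p V
   suffices. *)
exists (t / 2); first by rewrite divr_ge0.
have sosV : sos (\sum_i v i ^+ 2) by apply: sos_sum => i _; exact: sos_sqr.
rewrite hessian_formD hessian_formZ Hh.
have /(sosZ (_ : 0 <= t / 2)) := sos_hessian_form_sqdistB x p.
rewrite divr_ge0// => /(_ isT) HN.
have := sosD (sosD (sos_quad_form_loewner v muA) st) HN; congr sos.
move: (quad_form _ _) (\sum_i v i ^+ 2) (_ ^+ p) (hessian_form _) => q V Up HN'.
rewrite -!mul_mpolyC.
have tE : mpolyC (n + n) t = 2 * mpolyC (n + n) (t / 2).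
  by rewrite -mpolyC_nat -mpolyCM; congr mpolyC; field.
rewrite tE; ring.
Qed.

(** * Restriction to lines *)

Section LineRestriction.
Context {R : realType} {n : nat}.
Implicit Types (p q : mpoly n R) (a w : 'rV[R]_n).

Definition on_line a w p : {poly R} :=
  mmap polyC (fun i => (a 0 i)%:P + w 0 i *: 'X) p.

Lemma on_line_horner a w p s : (on_line a w p).[s] = peval p (a + s *: w).
Proof.
rewrite /on_line /mmap /peval mevalE horner_sum; apply: eq_bigr => m _.
rewrite hornerM hornerC /mmap1 horner_prod; congr (_ * _); apply: eq_bigr => i _.
by rewrite horner_exp hornerD hornerC hornerZ hornerX !mxE mulrC.
Qed.

Lemma on_lineD a w : {morph on_line a w : p q / p + q}.
Proof. by move=> p q; rewrite /on_line mmapD. Qed.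

Lemma on_lineM a w : {morph on_line a w : p q / p * q}.
Proof. by move=> p q; rewrite /on_line rmorphM. Qed.

Lemma mpoly_ring_ind (P : mpoly n R -> Prop) :
  (forall c, P (mpolyC n c)) -> (forall i, P (pvar i)) ->
  (forall p q, P p -> P q -> P (p + q)) -> (forall p q, P p -> P q -> P (p * q)) ->
  forall p, P p.
Proof.
move=> PC PX PD PM p; rewrite [p]mpolyE.
apply: (big_ind P) => [||m _]; [by rewrite -mpolyC0; exact: PC|exact: PD|].
rewrite -mul_mpolyC mpolyXE_id; apply: (PM) => //.
apply: (big_ind P) => [||i _]; [by rewrite -mpolyC1; exact: PC|exact: PM|].
elim: (fun_of_multinom m i) => [|k IH]; first by rewrite expr0 -mpolyC1; exact: PC.
by rewrite exprS; exact: PM (PX i) IH.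
Qed.

Lemma on_line_deriv a w p :
  (on_line a w p)^`() = \sum_i w 0 i *: on_line a w (mderiv i p).
Proof.
elim/mpoly_ring_ind: p => [c|i|p q IHp IHq|p q IHp IHq].
- rewrite /on_line mmapC derivC big1// => i _.
  by rewrite mderivC mmap0 scaler0.
- rewrite /on_line /pvar mmapX mmap1U derivD derivC add0r derivZ derivX.
  rewrite (bigD1 i)//= big1 => [|j ji].
    have -> : mderiv i (mpolyX R (mnm1 i)) = 1.
      by have := mderiv_varB i i (0 : R); rewrite mpolyC0 subr0 eqxx mpolyC1.
    by rewrite addr0 -mpolyC1 mmapC.
  have -> : mderiv j (mpolyX R (mnm1 i)) = 0.
    by have := mderiv_varB i j (0 : R); rewrite mpolyC0 subr0 eq_sym (negbTE ji) mpolyC0.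
  by rewrite mmap0 scaler0.
- rewrite on_lineD derivD IHp IHq -big_split; apply: eq_bigr => i _ /=.
  by rewrite mderivD on_lineD scalerDr.
- rewrite on_lineM derivM IHp IHq mulr_suml mulr_sumr -big_split; apply: eq_bigr => i _ /=.
  by rewrite mderivM on_lineD !on_lineM scalerDr -scalerAl -scalerAr.
Qed.

Lemma on_line_deriv2 a w p s :
  ((on_line a w p)^`()^`()).[s] = peval (hessian_form p) (row_mx (a + s *: w) w).
Proof.
have left q : meval (fun k => row_mx (a + s *: w) w 0 k) (lift_left q) = peval q (a + s *: w).
  rewrite comp_mpoly_meval; apply: meval_eq => k.
  by rewrite tnth_mktuple mevalXU row_mxEl.
rewrite on_line_deriv raddf_sum horner_sum /peval /hessian_form rmorph_sum.
apply: eq_bigr => i _; rewrite /= derivZ on_line_deriv hornerZ horner_sum mulr_sumr rmorph_sum.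
apply: eq_bigr => j _; rewrite hornerZ on_line_horner /= !mevalM !mevalXU !row_mxEr.
by rewrite mderiv_comm left; ring.
Qed.

Lemma peval0 p : peval p 0 = mcoeff mnm0 p.
Proof.
elim/mpoly_ring_ind: p => [c|i|p q IHp IHq|p q IHp IHq]; rewrite /peval.
- by rewrite mevalC mcoeffC eqxx mulr1.
- by rewrite mevalXU mcoeffX mnm1_eq0 mxE.
- by move: IHp IHq; rewrite /peval mevalD raddfD /= => -> ->.
- by move: IHp IHq; rewrite /peval mevalM rmorphM /= => -> ->.
Qed.

(** Induction on the degree of the monomial: a coefficient of degree k + 1 is, up to a positive
    factor, one of degree k of a partial derivative, and the partial derivatives vanish as functions
    because q vanishes along coordinate lines. *)
Lemma peval_eq0 p : (forall y, peval p y = 0) -> p = 0.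
Proof.
suff H k : forall m q, mdeg m = k -> (forall y, peval q y = 0) -> mcoeff m q = 0.
  by move=> p0; apply/mpolyP => m; rewrite mcoeff0 (H _ _ _ erefl).
elim: k => [m q /eqP|k IH m q mk q0].
  by rewrite mdeg_eq0 => /eqP -> q0; rewrite -peval0.
have [i mi] : exists i, (0 < m i)%N.
  apply/existsP; apply: contraPT mk; rewrite negb_exists => /forallP m0.
  by rewrite mdegE big1// => i _; apply/eqP; rewrite -leqn0 leqNgt.
have mE : m = mnm_add (mnm_sub m (mnm1 i)) (mnm1 i).
  by rewrite submK// lep1mP -lt0n.
have dq0 y : peval (mderiv i q) y = 0.
  have /(congr1 (fun r : {poly R} => r^`().[0])) : on_line y (delta_mx 0 i) q = 0.
    apply/eqP; apply: contraT => r0.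
    (* A nonzero polynomial has fewer distinct roots than its size, but all natural numbers below
       its size are roots here. *)
    have := max_poly_roots r0 (rs := [seq k%:R | k <- iota 0 (size (on_line y (delta_mx 0 i) q))]).
    rewrite size_map size_iota ltnn => -> //.
      by apply/allP => _ /mapP[l _ ->]; rewrite /root on_line_horner q0.
    by rewrite map_inj_uniq ?iota_uniq//; exact: mulrIn (oner_neq0 R).
  rewrite deriv0 horner0 on_line_deriv (bigD1 i)//= big1 => [|j ji].
    by rewrite addr0 mxE !eqxx scale1r on_line_horner scale0r addr0.
  by rewrite mxE eqxx (negbTE ji) scale0r.
have := IH (mnm_sub m (mnm1 i)) _ _ dq0.
rewrite mcoeff_deriv -mE => H; have /eqP : mdeg (mnm_sub m (mnm1 i)) = k.
  by have := congr1 mdeg mE; rewrite mk mdegD mdeg1 addn1 => -[].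
by move=> /eqP /H /eqP; rewrite mulrn_eq0 /= => /eqP.
Qed.

Lemma peval_inj p q : peval p =1 peval q -> p = q.
Proof.
move=> pq; apply/eqP; rewrite -subr_eq0; apply/eqP/peval_eq0 => y.
by rewrite /peval mevalB; apply/eqP; rewrite subr_eq0; apply/eqP; exact: pq.
Qed.

End LineRestriction.

(** * Closedness of the cone of sums of squares *)

(** Let r have the largest leading monomial. At the double of that monomial the sum has as
    coefficient a sum of real squares, one of them positive, so leading terms do not cancel. The
    monomial order refines the degree. *)
Lemma msize_sos {R : realType} n (s : seq (mpoly n R)) q :
  q \in s -> (mmeasure mdeg q <= mmeasure mdeg (\sum_(r <- s) r ^+ 2)%R)%N.
Proof.
move=> qs; have [->|q0] := eqVneq q 0; first by rewrite mmeasure0.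
have [r [rs r0 rmax]] : exists r, [/\ r \in s, r != 0 &
    forall r', r' \in s -> (mlead r' <= mlead r)%O].
  elim: s q qs q0 => // a s IH q; rewrite in_cons => qs q0.
  have [/hasP[b bs b0]|/hasPn s0] := boolP (has (predC1 0) s).
    have [r [rs r0 rmax]] := IH b bs b0.
    have [ar|ra] := leP (mlead a) (mlead r).
      exists r; split=> //; first by rewrite in_cons rs orbT.
      by move=> r'; rewrite in_cons => /orP[/eqP ->//|]; exact: rmax.
    exists a; split; first by rewrite in_cons eqxx.
      by apply: contraTneq ra => ->; rewrite mlead0 -leNgt le0m.
    move=> r'; rewrite in_cons => /orP[/eqP ->//|/rmax r'r].
    exact: le_trans r'r (ltW ra).
  exists q; split=> //.
  have zero b : b \in s -> b = 0 by move=> /s0; rewrite negbK => /eqP.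
  have qa : q = a by case/orP: qs => [/eqP //|/zero q00]; rewrite q00 eqxx in q0.
  by move=> r'; rewrite in_cons => /orP[/eqP ->|/zero ->]; rewrite ?qa// mlead0 le0m.
have coef : mcoeff (mnm_add (mlead r) (mlead r)) (\sum_(r <- s) r ^+ 2)
    = \sum_(r' <- s) (mcoeff (mlead r) r') ^+ 2.
  rewrite raddf_sum [LHS]big_seq [RHS]big_seq; apply: eq_bigr => r' r's.
  by rewrite /= expr2 mleadcMW ?rmax// expr2.
have : mnm_add (mlead r) (mlead r) \in msupp (\sum_(r <- s) r ^+ 2).
  rewrite mcoeff_msupp coef gt_eqF// (big_rem r)//=.
  apply: ltr_pwDl; last by apply: sumr_ge0 => i _; exact: sqr_ge0.
  by rewrite exprn_even_gt0//= mleadc_eq0.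
move=> /msize_mdeg_lt; rewrite mdegD; apply: leq_trans.
rewrite -mlead_deg// ltnS (leq_trans (lemc_mdeg (rmax _ qs)))//.
exact: leq_addr.
Qed.

Lemma continuous_sum {R : realType} {T : topologicalType} (I : Type) (r : seq I) (P : pred I)
    (F : I -> T -> R) :
  (forall i, P i -> continuous (F i)) -> continuous (fun x => \sum_(i <- r | P i) F i x).
Proof. by apply: continuous_big; exact: add_continuous. Qed.

Lemma continuous_coord_mul {R : realType} k (i j : 'I_k) (a : R) :
  continuous (fun c : 'rV[R]_k => c 0 i * c 0 j * a).
Proof.
move=> c; apply: (@cvgM _ _ (nbhs c)); last exact: cvg_cst.
by apply: (@cvgM _ _ (nbhs c)); exact: coord_continuous.
Qed.

Section SosCoefficients.
Context {R : realType} {n : nat}.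
Variable b : nat.

Let N := #|{: bmultinom n b}|.
Let expo (i : 'I_N) : multinom n := bmnm (enum_val i).
Let mon (i : 'I_N) : mpoly n R := mpolyX R (expo i).

(** A sum of N squares, parametrized by the matrix of their coefficients, flattened into a row
    vector for the compactness arguments. As [mmeasure mdeg] is the degree plus one for nonzero
    polynomials, the N monomials are those of degree less than [b]. *)
Definition sos_of (c : 'rV[R]_(N * N)) : mpoly n R :=
  \sum_k (\sum_i vec_mx c k i *: mon i) ^+ 2.

Lemma mpoly_mon q : (mmeasure mdeg q <= b)%N ->
  q = \sum_i mcoeff (expo i) q *: mon i.
Proof.
move=> qb; rewrite {1}(mpolywE qb).
rewrite (reindex (@enum_val _ (mem {: bmultinom n b})))//.
by exists enum_rank => m _; rewrite ?enum_valK ?enum_rankK.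
Qed.

Lemma sos_of_sos c : sos (sos_of c).
Proof. by apply: sos_sum => i _; exact: sos_sqr. Qed.

(** The Gram matrix of a sum of squares in the monomial basis is positive semidefinite; its
    factorization rewrites the sum with exactly N squares. *)
Lemma sos_ofP p : (mmeasure mdeg p <= b)%N -> sos p -> exists c, p = sos_of c.
Proof.
move=> pb [s pE]; pose B i j := \sum_(q <- s)
  mcoeff (expo i) q * mcoeff (expo j) q.
have form (S : comAlgType R) (z : 'I_N -> S) :
    quad_form B z = \sum_(q <- s) (\sum_i mcoeff (expo i) q *: z i) ^+ 2.
  rewrite /quad_form; under eq_bigr do under eq_bigr do rewrite scaler_suml.
  under eq_bigr do rewrite exchange_big.
  rewrite exchange_big; apply: eq_bigr => q _ /=.
  rewrite expr2 mulr_suml; apply: eq_bigr => i _; rewrite mulr_sumr.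
  by apply: eq_bigr => j _; rewrite -scalerAl -scalerAr scalerA.
have symB i j : B i j = B j i by apply: eq_bigr => q _; rewrite mulrC.
have psdB (v : 'I_N -> R^o) : 0 <= quad_form B v.
  by rewrite form; apply: sumr_ge0 => q _; exact: sqr_ge0.
have [L LE] := psd_quad_form (mpoly n R) symB psdB.
exists (mxvec L); rewrite /sos_of mxvecK -LE form pE.
rewrite [LHS]big_seq [RHS]big_seq; apply: eq_bigr => q qs.
by rewrite -mpoly_mon// (leq_trans (msize_sos qs))// -pE.
Qed.

Lemma mcoeff_mon i j : mcoeff (expo i) (mon j) = (i == j)%:R.
Proof.
by rewrite /mon mcoeffX eq_sym (inj_eq (inj_comp val_inj enum_val_inj)).
Qed.

Lemma sos_of_eq0 c : sos_of c = 0 -> c = 0.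
Proof.
move=> c0; suff c0' : vec_mx c = 0 by rewrite -[c]vec_mxK c0' linear0.
apply/matrixP => k i; rewrite [RHS]mxE.
pose F k := \sum_i vec_mx c k i *: mon i.
have FkS : F k \in [seq F k | k <- index_enum 'I_N] by apply: map_f; exact: mem_index_enum.
have := msize_sos FkS; rewrite big_map [\sum_(_ <- _) _]c0 mmeasure0 leqn0.
rewrite mmeasure_poly_eq0 => /eqP /(congr1 (mcoeff (expo i))).
rewrite mcoeff0 raddf_sum (bigD1 i)//= big1 => [|j ji].
  by rewrite addr0 mcoeffZ mcoeff_mon eqxx mulr1.
by rewrite mcoeffZ mcoeff_mon eq_sym (negbTE ji) mulr0.
Qed.

Lemma sos_ofZ a c : sos_of (a *: c) = a ^+ 2 *: sos_of c.
Proof.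
rewrite /sos_of scaler_sumr; apply: eq_bigr => k _; rewrite -exprZn scaler_sumr.
by congr (_ ^+ 2); apply: eq_bigr => i _; rewrite linearZ mxE scalerA.
Qed.

Lemma mcoeff_sos_of_continuous m : continuous (fun c => mcoeff m (sos_of c)).
Proof.
have E c : mcoeff m (sos_of c) = \sum_k \sum_i \sum_j
    c 0 (mxvec_index k i) * c 0 (mxvec_index k j) * mcoeff m (mon i * mon j).
  rewrite raddf_sum; apply: eq_bigr => k _ /=.
  rewrite expr2 mulr_suml raddf_sum; apply: eq_bigr => i _ /=.
  rewrite mulr_sumr raddf_sum; apply: eq_bigr => j _ /=.
  by rewrite -scalerAl -scalerAr scalerA mcoeffZ !mxE.
have -> : (fun c => mcoeff m (sos_of c)) = (fun c : 'rV[R]_(N * N) => \sum_k \sum_i \sum_j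
    c 0 (mxvec_index k i) * c 0 (mxvec_index k j) * mcoeff m (mon i * mon j)).
  exact/funext.
apply: continuous_sum => k _; apply: continuous_sum => i _; apply: continuous_sum => j _.
exact: continuous_coord_mul.
Qed.

(* Only a seminorm on all polynomials: coefficients of degree [b.*2] or more are
   ignored. *)
Definition coef_norm (p : mpoly n R) : R :=
  \sum_(m : bmultinom n b.*2) `|mcoeff m p|.

Lemma coef_norm_ge0 p : 0 <= coef_norm p.
Proof. exact: sumr_ge0. Qed.

Lemma coef_normZ a p : coef_norm (a *: p) = `|a| * coef_norm p.
Proof. by rewrite /coef_norm mulr_sumr; apply: eq_bigr => m _; rewrite mcoeffZ normrM. Qed.

Lemma coef_normD p q : coef_norm (p + q) <= coef_norm p + coef_norm q.
Proof.
by rewrite /coef_norm -big_split; apply: ler_sum => m _; rewrite mcoeffD ler_normD.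
Qed.

Lemma coef_norm_eq0 p : (mmeasure mdeg p <= b.*2)%N -> coef_norm p = 0 -> p = 0.
Proof.
move=> pb /psumr_eq0P p0; rewrite (mpolywE pb) big1// => m _.
by have /eqP := p0 (fun m _ => normr_ge0 _) m isT; rewrite normr_eq0 => /eqP ->; rewrite scale0r.
Qed.

Lemma msize_sos_of c : (mmeasure mdeg (sos_of c) <= b.*2)%N.
Proof.
apply: (leq_trans (mmeasure_sum _ _ _ _)); apply/bigmax_leqP => k _ /=.
set q := \sum_i _; have qb : (mmeasure mdeg q <= b)%N.
  apply: (leq_trans (mmeasure_sum _ _ _ _)); apply/bigmax_leqP => i _ /=.
  by rewrite (leq_trans (mmeasureZ_le _ _ _))// mmeasureX bmdeg.
have [->|q0] := eqVneq q 0; first by rewrite expr0n mmeasure0.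
by rewrite expr2 msizeM// (leq_trans (leq_pred _))// -addnn leq_add.
Qed.

Lemma coef_norm_continuous q : continuous (fun c => coef_norm (sos_of c - q)).
Proof.
apply: continuous_sum => m _.
have -> : (fun c => `|mcoeff m (sos_of c - q)|) = (fun c => `|mcoeff m (sos_of c) - mcoeff m q|).
  by apply/funext => c; rewrite mcoeffB.
move=> c; apply: (@cvg_norm _ _ _ (nbhs c)); apply: (@cvgB _ _ _ (nbhs c)).
  exact: mcoeff_sos_of_continuous.
exact: cvg_cst.
Qed.

(** The constant is the minimum over the unit sphere. It is positive because [sos_of c] has degree
    low enough for [coef_norm] to separate it from 0; homogeneity of degree two extends the bound to
    all vectors. *)
Lemma sos_of_coercive : exists2 e, 0 < e & forall c, e * `|c| ^+ 2 <= coef_norm (sos_of c).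
Proof.
pose S := [set c : 'rV[R]_(N * N) | `|c| = 1].
have S_scale c : c != 0 -> S (`|c|^-1 *: c).
  by move=> c0; rewrite /S/= normrZ ger0_norm ?invr_ge0// mulVf// normr_eq0.
(* An empty sphere means that the only vector is zero, and then any constant works. *)
have [S0|S0] := pselect (S !=set0); last first.
  exists 1 => // c; have [->|/S_scale Sc] := eqVneq c 0; last by case: S0; eexists; exact: Sc.
  by rewrite normr0 expr0n mulr0 coef_norm_ge0.
have cS : compact S.
  apply: bounded_closed_compact.
    exists 1; split; [exact: num_real|move=> M M1 c /= ->; exact: ltW].
  rewrite (_ : S = (@Num.norm _ _) @^-1` [set 1]); last by [].
  by apply: closed_comp; [move=> c _; exact: norm_continuous|exact: closed_eq].
have [|c0 c0S c0min] := @EVT_min_rV _ _ (fun c => coef_norm (sos_of c - 0)) S S0 cS.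
  by apply: continuous_subspaceT => c; exact: coef_norm_continuous.
exists (coef_norm (sos_of c0)).
  rewrite lt_neqAle coef_norm_ge0 andbT eq_sym; apply/eqP => /coef_norm_eq0.
  rewrite msize_sos_of => /(_ isT) /sos_of_eq0 c00.
  by move: c0S; rewrite inE /S/= c00 normr0 => /eqP; rewrite eq_sym oner_eq0.
move=> c; have [->|c_neq0] := eqVneq c 0.
  by rewrite normr0 expr0n mulr0 coef_norm_ge0.
have c_gt0 : 0 < `|c| by rewrite normr_gt0.
have := c0min (`|c|^-1 *: c); rewrite !subr0 sos_ofZ coef_normZ.
rewrite inE => /(_ (S_scale _ c_neq0)).
by rewrite ger0_norm ?sqr_ge0// exprVn mulrC ler_pdivlMr ?exprn_gt0.
Qed.

End SosCoefficients.

(** By coercivity the nearby sums of squares have coefficient vectors in a fixed ball. On this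
    compact ball the distance to the limit polynomial attains its minimum, which the approximations
    force to be zero. *)
Lemma sos_closed_ray {R : realType} n (p0 p1 : mpoly n R) (t0 : R) :
  (forall e, 0 < e -> exists t, `|t - t0| < e /\ sos (p0 + t *: p1)) ->
  sos (p0 + t0 *: p1).
Proof.
move=> approx; pose b := maxn (mmeasure mdeg p0) (mmeasure mdeg p1).
have msize_ray t : (mmeasure mdeg (p0 + t *: p1) <= b)%N.
  apply: (leq_trans (msizeD_le _ _)); rewrite geq_max leq_maxl.
  by rewrite (leq_trans (mmeasureZ_le _ _ _))// leq_maxr.
have [e e0 coer] := @sos_of_coercive R n b.
(* The quotient bounds the squared norm of [c] when |t - t0| < 1; adding 1 makes [M] at least 1, so
   that it bounds the norm too. *)
pose M := (coef_norm b p0 + (`|t0| + 1) * coef_norm b p1) / e + 1.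
have M1 : 1 <= M.
  rewrite /M lerDr; apply: divr_ge0; last exact: ltW.
  by apply: addr_ge0; rewrite ?coef_norm_ge0// mulr_ge0 ?coef_norm_ge0 ?addr_ge0.
pose K := [set c : 'rV[R]_(#|{: bmultinom n b}| * #|{: bmultinom n b}|) | `|c| <= M].
have in_K t c : `|t - t0| < 1 -> p0 + t *: p1 = sos_of c -> K c.
  move=> tt0 pE; have := coer c; rewrite -pE => cle; rewrite /K/=.
  have {}cle : `|c| ^+ 2 <= M.
    rewrite (le_trans (_ : _ <= M - 1))// ?lerBlDr ?lerDl// /M addrK ler_pdivlMr// mulrC.
    rewrite (le_trans cle)// (le_trans (coef_normD _ _ _))// lerD2l coef_normZ.
    rewrite ler_wpM2r ?coef_norm_ge0// -[t](subrK t0) addrC (le_trans (ler_normD _ _))//.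
    by rewrite lerD2l ltW.
  have [c1|c1] := leP `|c| 1; first exact: le_trans c1 M1.
  by apply: le_trans cle; rewrite expr2 ler_peMr// ltW.
have K0 : K !=set0.
  have [t [tt0 /(sos_ofP (msize_ray t))[c cE]]] := approx 1 ltr01.
  by exists c; exact: in_K tt0 cE.
have cK : compact K.
  apply: bounded_closed_compact.
    by exists M; split; [exact: num_real|move=> r Mr c /= cM; exact: le_trans cM (ltW Mr)].
  rewrite (_ : K = (@Num.norm _ _) @^-1` [set r | r <= M])//.
  by apply: closed_comp; [move=> c _; exact: norm_continuous|exact: closed_le].
have [|c0 _ c0min] := @EVT_min_rV _ _ (fun c => coef_norm b (sos_of c - (p0 + t0 *: p1))) K K0 cK.
  by apply: continuous_subspaceT => c; exact: coef_norm_continuous.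
suff c00 : coef_norm b (sos_of c0 - (p0 + t0 *: p1)) = 0.
  have /eqP : sos_of c0 - (p0 + t0 *: p1) = 0.
    apply: coef_norm_eq0 c00; rewrite (leq_trans (msizeD_le _ _))// geq_max msize_sos_of.
    by rewrite mmeasureN (leq_trans (msize_ray _))// -addnn leq_addr.
  by rewrite subr_eq0 => /eqP <-; exact: sos_of_sos.
apply/eqP; rewrite eq_le coef_norm_ge0 andbT.
apply/ler_addgt0Pr => d d0; rewrite add0r.
have p1_gt0 : 0 < coef_norm b p1 + 1 by rewrite ltr_wpDl ?coef_norm_ge0.
have [t [tt0 t_sos]] : exists t, `|t - t0| < Num.min 1 (d / (coef_norm b p1 + 1)) /\
    sos (p0 + t *: p1).
  by apply: approx; rewrite lt_min ltr01 divr_gt0.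
have [c cE] := sos_ofP (msize_ray t) t_sos.
move: tt0; rewrite lt_min ltr_pdivlMr// => /andP[tt01 tt0d].
apply: le_trans (c0min c _) _; first by rewrite inE; exact: in_K tt01 cE.
rewrite -cE (_ : _ - _ = (t - t0) *: p1) ?coef_normZ; last first.
  by rewrite scalerBl opprD addrACA subrr add0r.
apply: le_trans (ltW tt0d); rewrite ler_wpM2l//.
by rewrite lerDl.
Qed.

(** * Minimization of SOS-convex polynomials *)

Lemma peval_continuous {R : realType} n (p : mpoly n R) : continuous (peval p).
Proof.
elim/(@mpoly_ring_ind R n): p => [a|i|p q p_cont q_cont|p q p_cont q_cont].
- rewrite (_ : peval _ = cst a); first exact: cst_continuous.
  by apply/funext => y; rewrite /peval mevalC.
- rewrite (_ : peval _ = fun y => y 0 i); first exact: coord_continuous.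
  by apply/funext => y; rewrite /peval mevalXU.
- rewrite (_ : peval _ = peval p \+ peval q); first
    by move=> y; apply: (@cvgD _ _ _ (nbhs y)); [exact: p_cont|exact: q_cont].
  by apply/funext => y; rewrite /peval mevalD.
- rewrite (_ : peval _ = peval p \* peval q); first
    by move=> y; apply: (@cvgM _ _ (nbhs y)); [exact: p_cont|exact: q_cont].
  by apply/funext => y; rewrite /peval mevalM.
Qed.

Section ConvexPolynomials.
Context {R : realType}.

(** The slopes over [0, l] and [l, 1] are derivatives at points a < b, and the derivative is
    nondecreasing. *)
Lemma poly_convex (p : {poly R}) l :
  (forall s, 0 <= (p^`()^`()).[s]) -> 0 <= l <= 1 ->
  p.[l] <= (1 - l) * p.[0] + l * p.[1].
Proof.
move=> p2 /andP[]; rewrite le_eqVlt => /predU1P[<- _|l0].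
  by rewrite subr0 mul1r mul0r addr0.
rewrite le_eqVlt => /predU1P[->|l1]; first by rewrite subrr mul0r mul1r add0r.
have [a] := polyrcf.poly_mvt p l0; rewrite in_itv/= subr0 => /andP[a0 al] pa.
have [b] := polyrcf.poly_mvt p l1; rewrite in_itv/= => /andP[lb b1] pb.
have [c _ pc] := polyrcf.poly_mvt p^`() (lt_trans al lb).
have : 0 <= p^`().[b] - p^`().[a] by rewrite pc mulr_ge0// subr_ge0 ltW// (lt_trans al).
have l1l : 0 <= l * (1 - l) by rewrite mulr_ge0// ?subr_ge0 ltW.
by move=> /(mulr_ge0 l1l); nra.
Qed.

(** A nonzero polynomial that is nowhere negative has positive leading coefficient; applied to p'',
    this makes p of degree at least 2 with positive leading coefficient. *)
Lemma poly_convex_infty (p : {poly R}) a c :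
  (forall s, 0 <= (p^`()^`()).[s]) -> (p^`()^`()).[a] != 0 ->
  exists s0, forall s, s0 <= s -> c <= p.[s].
Proof.
move=> p2 p2a; set q := p^`()^`() in p2 p2a.
have q0 : q != 0 by apply: contraNneq p2a => ->; rewrite horner0.
have lq : 0 < lead_coef q.
  rewrite lt_neqAle eq_sym lead_coef_eq0 q0 leNgt; apply/negP => lq.
  have [|s] := @polyrcf.poly_pinfty_gt_lc R (- q); first by rewrite lead_coefN oppr_gt0.
  move=> /(_ s (lexx _)); rewrite lead_coefN hornerN lerN2 => /le_lt_trans/(_ lq).
  by rewrite ltNge p2.
have sq : size q = (size p).-2 by rewrite /q !polyorder.size_deriv.
have sp : (2 < size p)%N by move: q0; rewrite -size_poly_gt0 sq; case: (size p) => [|[|[]]].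
apply: polyrcf.poly_lim_infty; last exact: ltnW.
move: lq; rewrite !lead_coefE sq /q !coef_deriv.
case: (size p) sp => [|[|[|k]]]//= _.
by rewrite !pmulrn_lgt0.
Qed.

Context {n : nat}.
Variable P : mpoly n R.
Hypothesis P_sos : sos (hessian_form P).

Lemma sos_peval_ge0 m (p : mpoly m R) y : sos p -> 0 <= peval p y.
Proof.
move=> [s ->]; rewrite /peval rmorph_sum; apply: sumr_ge0 => q _.
by rewrite rmorphXn sqr_ge0.
Qed.

Lemma sos_convex_peval a b l : 0 <= l <= 1 ->
  peval P (a + l *: (b - a)) <= (1 - l) * peval P a + l * peval P b.
Proof.
move=> l01; have := @poly_convex (on_line a (b - a) P) l _ l01.
rewrite !on_line_horner scale0r addr0 scale1r [a + (b - a)]addrC subrK; apply => s.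
by rewrite on_line_deriv2; exact: sos_peval_ge0.
Qed.

Lemma sos_convex_ray x w c : 0 < peval (hessian_form P) (row_mx x w) ->
  exists s0, forall s, s0 <= s -> c <= peval P (x + s *: w).
Proof.
move=> xw; have [||s0 s0P] := @poly_convex_infty (on_line x w P) 0 c.
- by move=> s; rewrite on_line_deriv2; exact: sos_peval_ge0.
- by rewrite on_line_deriv2 scale0r addr0 gt_eqF.
by exists s0 => s /s0P; rewrite on_line_horner.
Qed.

Lemma sos_convex_sublevel_bounded x c :
  (forall w, w != 0 -> 0 < peval (hessian_form P) (row_mx x w)) ->
  exists M, forall y, peval P y <= c -> `|y - x| <= M.
Proof.
move=> posx; wlog cx : c / peval P x <= c.
  move=> wl; have [|M HM] := wl (Num.max c (peval P x)); first by rewrite le_max lexx orbT.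
  by exists M => y yc; apply: HM; rewrite le_max yc.
pose S := [set w : 'rV[R]_n | `|w| = 1].
have cS : compact S.
  apply: bounded_closed_compact.
    exists 1; split; [exact: num_real|move=> M M1 w /= ->; exact: ltW].
  rewrite (_ : S = (@Num.norm _ _) @^-1` [set 1]); last by [].
  by apply: closed_comp; [move=> w _; exact: norm_continuous|exact: closed_eq].
(* Directions in which [P] exceeds [c] at parameter k. They cover the unit sphere, and the largest
   index of a finite subcover bounds the distance to [x]. *)
pose O (k : nat) := [set w : 'rV[R]_n | c < peval P (x + k%:R *: w)].
have O_open k : setT k -> open (O k).
  move=> _; rewrite (_ : O k = (fun w => peval P (x + k%:R *: w)) @^-1` [set r | c < r])//.
  apply: open_comp; last exact: open_gt.
  move=> w _; apply: (@cvg_comp _ _ _ (fun w => x + k%:R *: w) (peval P) (nbhs w)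
    (nbhs (x + k%:R *: w))); last exact: peval_continuous.
  by apply: (@cvgD _ _ _ (nbhs w)); [exact: cvg_cst|exact: scaler_continuous].
have S_cover : S `<=` cover setT O.
  move=> w Sw; have w0 : w != 0 by apply: contra_eq_neq Sw => ->; rewrite normr0 eq_sym oner_neq0.
  have [s0 s0P] := sos_convex_ray (c + 1) (posx w w0).
  exists (Num.truncn `|s0|).+1 => //; rewrite /O/=.
  apply: lt_le_trans (s0P _ _); first by rewrite ltrDl.
  by rewrite (le_trans (ler_norm _))// ltW// truncnS_gt.
have := cS; rewrite compact_cover => /(_ _ _ _ O_open S_cover)[D _ D_cover].
pose K := (\max_(k <- finmap.enum_fset D) k)%N.
exists K%:R => y yc; rewrite leNgt; apply/negP => Ky.
have y0 : 0 < `|y - x| by rewrite (le_lt_trans _ Ky).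
have [|k kD] := D_cover (`|y - x|^-1 *: (y - x)).
  by rewrite /S/= normrZ ger0_norm ?invr_ge0// mulVf// gt_eqF.
rewrite /O/= => ck.
have kK : (k <= K)%N by apply: leq_bigmax_seq.
have l01 : 0 <= k%:R / `|y - x| <= 1.
  rewrite divr_ge0//= ler_pdivrMr// mul1r (le_trans _ (ltW Ky))//.
  by rewrite ler_nat.
(* The point at parameter k towards [y] lies on the segment from [x] to [y]; as [P] is at most [c]
   at both ends, convexity contradicts [ck]. *)
have := sos_convex_peval x y l01; rewrite -scalerA leNgt => /negP; apply.
apply: le_lt_trans ck; move: l01 yc cx.
by move: (_ / _) (peval P x) (peval P y) => l px py; nra.
Qed.

Lemma sos_convex_minimizer_exists x (C : set 'rV[R]_n) :
  (forall w, w != 0 -> 0 < peval (hessian_form P) (row_mx x w)) ->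
  closed C -> C !=set0 -> exists y, optimal_solution (peval P) C y.
Proof.
move=> posx C_closed [y0 Cy0]; pose A := C `&` [set y | peval P y <= peval P y0].
have [M HM] := sos_convex_sublevel_bounded (peval P y0) posx.
have cA : compact A.
  apply: bounded_closed_compact.
    exists (M + `|x|); split; first exact: num_real.
    move=> r Mr y [_ /HM yM] /=; rewrite -[y](subrK x) (le_trans (ler_normD _ _))//.
    by rewrite (le_trans _ (ltW Mr))// lerD2r.
  apply: closedI => //.
  rewrite (_ : [set _ | _] = peval P @^-1` [set r | r <= peval P y0])//.
  by apply: closed_comp; [move=> y _; exact: peval_continuous|exact: closed_le].
have [||y yA ymin] := @EVT_min_rV _ _ (peval P) A _ cA.
- by exists y0; split=> //=.
- exact/continuous_subspaceT/peval_continuous.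
move: yA; rewrite inE => -[Cy /= yy0].
exists y; split=> // z Cz; have [zy0|/ltW zy0] := leP (peval P z) (peval P y0).
  by apply: ymin; rewrite inE.
exact: le_trans yy0 zy0.
Qed.

Lemma sos_convex_minimizer_unique x (C : set 'rV[R]_n) y1 y2 :
  (forall w, w != 0 -> 0 < peval (hessian_form P) (row_mx x w)) ->
  (forall a b l, C a -> C b -> 0 <= l <= 1 -> C (a + l *: (b - a))) ->
  optimal_solution (peval P) C y1 -> optimal_solution (peval P) C y2 -> y1 = y2.
Proof.
move=> posx C_convex [Cy1 min1] [Cy2 min2]; apply/eqP; apply: contraT => y12.
set w := y2 - y1; have w0 : w != 0 by rewrite subr_eq0 eq_sym.
set m := peval P y1; have m2 : peval P y2 = m.
  by apply/eqP; rewrite eq_le min1// min2.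
have segment s : 0 <= s <= 1 -> peval P (y1 + s *: w) = m.
  move=> s01; apply/eqP; rewrite eq_le min1 ?andbT; last exact: C_convex.
  by have := sos_convex_peval y1 y2 s01; rewrite m2 -/m -mulrDl subrK mul1r.
(* A polynomial constant on [0, 1] is constant: its difference with [m] has the roots 1, 1/2, 1/3,
   and so on, as many as its size. *)
have line s : peval P (y1 + s *: w) = m.
  apply/eqP; rewrite -on_line_horner -subr_eq0 -[X in _ - X](hornerC m s) -hornerN -hornerD.
  rewrite [X in X.[s]](_ : _ = 0) ?horner0//; apply/eqP; apply: contraT => r0.
  set r := (X in X != 0) in r0.
  have := max_poly_roots r0 (rs := [seq k.+1%:R^-1 | k <- iota 0 (size r)]).
  rewrite size_map size_iota ltnn => -> //.
    apply/allP => _ /mapP[k _ ->]; rewrite /root !hornerE on_line_horner segment ?subrr//.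
    by rewrite invr_ge0 ler0n/= invf_le1// ler1n.
  rewrite map_inj_uniq ?iota_uniq// => i j /invr_inj /eqP.
  by rewrite eqr_nat eqSS => /eqP.
have [s0 s0P] := sos_convex_ray (peval P x + 1) (posx w w0).
have {s0P} := s0P s0 (lexx _); set q := on_line (x + s0 *: w) (y1 - x) P.
have -> : x + s0 *: w = x + s0 *: w + 0 *: (y1 - x) by rewrite scale0r addr0.
rewrite -on_line_horner -/q => q0.
(* The segment from [x] to the far point y1 + (s0 / l) w of the flat line passes at parameter l
   through x + s0 w + l (y1 - x). Convexity there says that [r] is at most 0 on (0, 1], while its
   value at 0 is at least 1. *)
pose r : {poly R} := q - (peval P x)%:P - (m - peval P x) *: 'X.
have r_le0 l : 0 < l <= 1 -> r.[l] <= 0.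
  move=> /andP[l0 l1]; rewrite !hornerE on_line_horner.
  have := sos_convex_peval x (y1 + (s0 / l) *: w) (l := l); rewrite (ltW l0) l1 => /(_ isT).
  rewrite line (_ : x + l *: (_ - x) = x + s0 *: w + l *: (y1 - x)); first by lra.
  have -> : y1 + (s0 / l) *: w - x = (s0 / l) *: w + (y1 - x) by rewrite -addrA addrCA.
  by rewrite scalerDr scalerA mulrCA divff ?gt_eqF// mulr1 addrA.
have r0 : 1 <= r.[0] by rewrite !hornerE; lra.
have [e e0 re] := polyrcf.poly_cont 0 r ltr01.
pose l := Num.min 1 (e / 2).
have l0 : 0 < l by rewrite lt_min ltr01 divr_gt0.
have le : l < e by rewrite gt_min ltr_pdivrMr// ltr_pMr// ltr1n orbT.
have := re l; rewrite subr0 gtr0_norm// => /(_ le); rewrite ltr_norml => /andP[+ _].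
have := r_le0 l; rewrite l0 ge_min lexx => /(_ isT).
by lra.
Qed.

End ConvexPolynomials.

(** * The regularized subproblem *)

Section HessianAtCenter.
Context {R : realType} {n : nat}.
Variables x w : 'rV[R]_n.

Let at_center (p : mpoly (n + n) R) : R := peval p (row_mx x w).

Let at_centerD : {morph at_center : p q / p + q}.
Proof. by move=> p q; rewrite /at_center /peval mevalD. Qed.

Let at_centerM : {morph at_center : p q / p * q}.
Proof. by move=> p q; rewrite /at_center /peval mevalM. Qed.

Let at_center0 : at_center 0 = 0.
Proof. exact: meval0. Qed.

Lemma at_center_shifted_var i : at_center (lift_left (shifted_var x i)) = 0.
Proof.
rewrite /at_center /peval /lift_left comp_mpoly_meval mevalB mevalXU mevalC.
by rewrite tnth_mktuple mevalXU row_mxEl subrr.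
Qed.

(** At y = x every factor u vanishes, and two differentiations remove all factors only in degree
    2. *)
Lemma at_center_hessian_form_mon s : size s != 2 ->
  at_center (hessian_form (shifted_mon x s)) = 0.
Proof.
case: s => [|i s] s2; first by rewrite /shifted_mon big_nil hessian_form1.
rewrite hessian_form_shifted_mon at_centerD !at_centerM at_center_shifted_var mul0r addr0.
suff -> : at_center (grad_form (shifted_mon x s)) = 0 by rewrite !mulr0.
case: s s2 => [|j s] s2; first by rewrite /shifted_mon big_nil grad_form1.
rewrite grad_form_shifted_mon at_centerD !at_centerM at_center_shifted_var mul0r addr0.
case: s s2 => [//|k s] _; rewrite /umon big_cons at_centerM.
by rewrite at_center_shifted_var mul0r mulr0.
Qed.

Lemma at_center_hessian_form_taylor d f : (2 <= d)%N ->
  at_center (hessian_form (taylor_poly x d f)) = dotv (w *m hessian f x) w.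
Proof.
move=> d2; have d2' : (2 < d.+1)%N by [].
rewrite hessian_form_sum /at_center /peval rmorph_sum (bigD1 (Ordinal d2'))//= [X in _ + X]big1 ?addr0.
  rewrite hessian_formZ hessian_form_sum; under eq_bigr do rewrite hessian_formZ.
  rewrite hessian_form_taylor_poly2 scalerA mulVf ?scale1r ?pnatr_eq0//.
  rewrite /quad_form /dotv exchange_big rmorph_sum; apply: eq_bigr => i _ /=.
  rewrite mxE mulr_suml rmorph_sum; apply: eq_bigr => j _ /=.
  by rewrite mevalZ mevalM !mevalXU !row_mxEr; ring.
move=> k k2; rewrite hessian_formZ mevalZ hessian_form_sum rmorph_sum big1 ?mulr0// => s _ /=.
rewrite hessian_formZ mevalZ -/(peval _ _) -/(at_center _) at_center_hessian_form_mon ?mulr0//.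
by rewrite size_tuple.
Qed.

End HessianAtCenter.

Lemma loewner_le_pos {R : realType} n (A : 'M[R]_n) (mu : R) w :
  0 < mu -> loewner_le mu%:M A -> w != 0 -> 0 < dotv (w *m A) w.
Proof.
move=> mu0 /(_ w); rewrite mulmxBr mul_mx_scalar.
have -> : dotv (w *m A - mu *: w) w = dotv (w *m A) w - mu * dotv w w.
  by rewrite /dotv mulr_sumr -sumrB; apply: eq_bigr => i _; rewrite !mxE; ring.
rewrite subr_ge0 => muA w0; apply: lt_le_trans muA; rewrite mulr_gt0// /dotv.
have [i wi] : exists i, w 0 i != 0.
  apply/existsP; apply: contraNT w0; rewrite negb_exists => /forallP wi0.
  by apply/eqP/rowP => i; rewrite mxE; apply/eqP; have := wi0 i; rewrite negbK.
rewrite (bigD1 i)//= ltr_pwDl//; first by rewrite -expr2 exprn_even_gt0.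
by apply: sumr_ge0 => j _; rewrite -expr2 sqr_ge0.
Qed.

Section RegularizedSubproblem.
Context {R : realType} {n : nat}.
Variables (d p : nat) (f : 'rV[R]_n -> R) (x : 'rV[R]_n) (mu : R).
Hypothesis dp : (2 <= d <= p.*2.+2)%N.
Hypotheses (mu_gt0 : 0 < mu) (mu_hess : loewner_le mu%:M (hessian f x)).

Definition regularized_poly (t : R) : mpoly n R :=
  taylor_poly x d f + t *: sqdist_poly x ^+ p.+1.

Lemma peval_regularized_poly t :
  regularized_taylor d p.+1.*2 f x t = peval (regularized_poly t).
Proof.
apply/funext => y; rewrite /regularized_poly /peval mevalD mevalZ -!/(peval _ _).
by rewrite peval_taylor_poly peval_sqdist_poly.
Qed.

(** A polynomial is determined by its values, so the witness in [sos_convex] must be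
    [regularized_poly t]. *)
Lemma feasible_weightsE t : feasible_weights d p.+1.*2 f x t <->
  0 <= t /\ sos (hessian_form (regularized_poly t)).
Proof.
split=> -[t0].
  rewrite peval_regularized_poly => -[P PE P_sos]; split=> //.
  by rewrite (@peval_inj _ _ (regularized_poly t) P).
by move=> t_sos; split=> //; rewrite peval_regularized_poly; exists (regularized_poly t).
Qed.

Lemma feasible_weights_nonempty : exists t, feasible_weights d p.+1.*2 f x t.
Proof.
have [t t0 t_sos] := sos_hessian_form_regularized dp mu_gt0 mu_hess.
by exists t; apply/feasible_weightsE.
Qed.

(** The feasible weights are nonempty and bounded below by 0. Their infimum is a limit of feasible
    weights, hence feasible since the Hessian form is affine in t and the cone is closed along such
    a ray. *)
Lemma minima_tmin : minima (feasible_weights d p.+1.*2 f x) (tmin d p.+1.*2 f x).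
Proof.
rewrite /tmin; apply: xgetPex; set S := feasible_weights _ _ _ _.
have S_lb : lbound S 0 by move=> t [].
have S_inf : has_inf S by split; [exact: feasible_weights_nonempty|exists 0].
exists (inf S); split; last by move=> t; apply: ge_inf; exists 0.
apply/feasible_weightsE; split; first by apply: lb_le_inf => //; case: S_inf.
rewrite /regularized_poly hessian_formD hessian_formZ; apply: sos_closed_ray => e e0.
have [t St te] := inf_adherent e0 S_inf; exists t; split.
  rewrite ger0_norm ?subr_ge0; last by apply: ge_inf => //; exists 0.
  by rewrite ltrBlDl.
by case/feasible_weightsE: St => _; rewrite /regularized_poly hessian_formD hessian_formZ.
Qed.

Lemma hessian_form_regularized_pos t w : 0 <= t -> w != 0 ->
  0 < peval (hessian_form (regularized_poly t)) (row_mx x w).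
Proof.
move=> t0 w0; rewrite /regularized_poly hessian_formD hessian_formZ /peval mevalD mevalZ.
rewrite -!/(peval _ _) at_center_hessian_form_taylor; last by case/andP: dp.
rewrite ltr_pwDl ?(loewner_le_pos mu_gt0 mu_hess)// mulr_ge0// sos_peval_ge0//.
exact: sos_hessian_form_sqdist.
Qed.

End RegularizedSubproblem.

(** The conjunct on [minima] ensures that [tmin] is the attained minimum and not the default value
    of [xget], so that [psi] is the intended function. *)
Theorem theorem5p4 (R : realType) (n m d d' : nat)
    (hd : (2 <= d)%N) (hd' : smallest_even_gt d d')
    (f : 'rV[R]_n -> R)
    (f_diff : continuously_differentiable d f) (f_sc : strongly_convex f)
    (g : 'I_m -> 'rV[R]_n -> R) (g_sos : forall i, sos_convex (g i))
    (C : set 'rV[R]_n) (hC : C = [set x | forall i, g i x <= 0])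
    (C_int : interior C !=set0) (x : 'rV[R]_n) :
  (exists t, feasible_weights d d' f x t) /\
  (minima (feasible_weights d d' f x) (tmin d d' f x) /\
   exists! y, optimal_solution (psi d d' f x) C y).
Proof.
case: hd' => d'_even dd' _; case: f_sc => mu mu0 /(_ x) mu_hess.
(* Chosen so that d' = 2 (p + 1): the regularizer is the power p + 1 of the squared distance, and d
   < d' gives d <= 2p + 2. *)
pose p := d'./2.-1.
have d'E : d' = p.+1.*2.
  rewrite /p prednK ?even_halfK//; first by rewrite half_gt0 (leq_trans hd)// ltnW.
have dp : (2 <= d <= p.*2.+2)%N by rewrite hd -doubleS -d'E ltnW.
rewrite {}d'E in d'_even dd' *.
have tmin_min := minima_tmin dp mu0 mu_hess.
split; first exact: (feasible_weights_nonempty dp mu0 mu_hess).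
split=> //.
have [/feasible_weightsE[t0 t_sos] _] := tmin_min.
rewrite /psi peval_regularized_poly.
move: (tmin _ _ _ _) t0 t_sos => t t0 t_sos.
have posx w := @hessian_form_regularized_pos _ _ d p f x mu dp mu0 mu_hess t w t0.
have C_closed : closed C.
  rewrite hC (_ : [set _ | _] = \bigcap_i (g i @^-1` [set r | r <= 0])).
    apply: closed_bigI => i _; have [P /funext -> _] := g_sos i.
    by apply: closed_comp; [move=> y _; exact: peval_continuous|exact: closed_le].
  by apply/seteqP; split=> y Cy i; [move=> _; exact: Cy|exact: Cy].
have C_convex a b l : C a -> C b -> 0 <= l <= 1 -> C (a + l *: (b - a)).
  rewrite hC /= => Ca Cb l01 i; have [P /funext gE P_sos] := g_sos i.
  have := Ca i; have := Cb i; rewrite gE => Pb Pa.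
  apply: le_trans (sos_convex_peval P_sos a b l01) _.
  by case/andP: l01 => l0 l1; nra.
have C0 : C !=set0 by case: C_int => y /interior_subset; exists y.
have [y y_opt] := sos_convex_minimizer_exists t_sos posx C_closed C0.
exists y; split=> // z z_opt; exact: sos_convex_minimizer_unique posx C_convex y_opt z_opt.
Qed.
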